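(* Consider $k$ steps of the joint bidiagonalization (JBD) process of $\{A,L\}$ in which the inner least squares problems $\min_{\tilde z\in\mathbb{R}^n}\|C\tilde z-\tilde u_i\|$ are solved inexactly with stopping criterion $\|C^T\bar r_i\|/(\|C\|\|\bar r_i\|)\le\tau$ (see context). Then there exist vectors $\tilde g_i\in\mathcal{R}(Q)$, $i=1,\dots,k$, such that $$\beta_i\tilde v_{i+1}=QQ^T\begin{pmatrix}u_i\\0_p\end{pmatrix}-\alpha_i\tilde v_i-\tilde g_i,\qquad i=1,\dots,k.$$ If moreover $\kappa(C)\tau<1$, then $$\|\tilde g_i\|\le 3\kappa(C)\tau+\mathcal{O}(\kappa(C)^2\tau^2).$$
   Context: $\|\cdot\|$ is the 2-norm; $\mathcal{R}(\cdot)$ is the range; $0_p$ is the zero vector of $\mathbb{R}^p$. Let $A\in\mathbb{R}^{m\times n}$, $L\in\mathbb{R}^{p\times n}$, $C=\begin{pmatrix}A\\L\end{pmatrix}$ with $\mathrm{rank}(C)=n$, $\kappa(C)=\|C\|\|C^\dagger\|$, and let $C=QR$ be the compact QR factorization, $Q\in\mathbb{R}^{(m+p)\times n}$ with orthonormal columns, $R\in\mathbb{R}^{n\times n}$ upper triangular and nonsingular. JBD process with inexact inner iterations: choose a nonzero $s\in\mathbb{R}^n$, set $\tilde v_1=Cs/\|Cs\|$, $\beta_0=\hat\beta_0=0$, and for $i=1,\dots,k$: (1) $\alpha_iu_i=\tilde v_i(1:m)-\beta_{i-1}u_{i-1}$, $\|u_i\|=1$; (2) with $\tilde u_i=(u_i^T,0_p^T)^T$,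 compute an approximate solution $\bar z_i$ of $\min_{\tilde z}\|C\tilde z-\tilde u_i\|$ whose residual $\bar r_i=\tilde u_i-C\bar z_i$ satisfies $\|C^T\bar r_i\|/(\|C\|\|\bar r_i\|)\le\tau$ (stopping tolerance $\tau>0$); (3) $\beta_i\tilde v_{i+1}=C\bar z_i-\alpha_i\tilde v_i$, $\|\tilde v_{i+1}\|=1$; (4) $\hat\alpha_i\hat u_i=(-1)^{i-1}\tilde v_i(m+1:m+p)-\hat\beta_{i-1}\hat u_{i-1}$, $\|\hat u_i\|=1$; $\hat\beta_i=\alpha_i\beta_i/\hat\alpha_i$. Here $\alpha_i,\beta_i,\hat\alpha_i>0$ are normalizing constants (the process does not break down in the first $k$ steps). All computations other than the inner solve (2) are exact (no rounding errors). The $\mathcal{O}$ term is as $\kappa(C)\tau\to0$, with an absolute constant. *)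

(* Defs.v *)
From HB Require Import structures.
From mathcomp Require Import all_boot all_order all_algebra.
From mathcomp Require Import all_classical all_reals all_analysis.

Set Implicit Arguments.
Unset Strict Implicit.
Unset Printing Implicit Defensive.

Import Order.TTheory GRing.Theory Num.Theory.

Local Open Scope classical_set_scope.
Local Open Scope ring_scope.

(* The norm `|x| that MathComp-Analysis puts on matrices is the max norm, so
   the Euclidean norm and the spectral norm are defined here. *)
Definition norm2 (R : realType) (d : nat) (x : 'cV[R]_d) : R :=
  Num.sqrt (\sum_(i < d) x i 0 ^+ 2).

Definition mxnorm2 (R : realType) (m n : nat) (M : 'M[R]_(m, n)) : R :=
  sup [set norm2 (M *m x) | x in [set x : 'cV[R]_n | norm2 x <= 1]].

(* mxalgebra's pinvmx is only a generalized inverse (M *m pinvmx M *m M = M),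
   not the Moore-Penrose inverse, which is specified by the Penrose equations. *)
Definition penrose (R : realType) (m n : nat)
    (M : 'M[R]_(m, n)) (X : 'M[R]_(n, m)) : Prop :=
  [/\ M *m X *m M = M, X *m M *m X = X,
      (M *m X)^T = M *m X & (X *m M)^T = X *m M].

Definition mppinv (R : realType) (m n : nat) (M : 'M[R]_(m, n)) : 'M[R]_(n, m) :=
  xget 0 [set X | penrose M X].

Lemma penrose_uniq (R : realType) (m n : nat) (M : 'M[R]_(m, n))
    (X Y : 'M[R]_(n, m)) : penrose M X -> penrose M Y -> X = Y.
Proof.
move=> [MXM XMX MXt XMt] [MYM YMY MYt YMt].
have MXY : M *m X = M *m Y.
  rewrite -{1}MYM -[M *m Y *m M *m X]mulmxA -MYt -MXt -trmx_mul.
  by rewrite mulmxA MXM MYt.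
have XMY : X *m M = Y *m M.
  rewrite -{1}MYM -[M *m Y *m M]mulmxA mulmxA -YMt -XMt -trmx_mul.
  by rewrite -mulmxA (mulmxA M X M) MXM YMt.
by rewrite -XMX XMY -mulmxA MXY mulmxA YMY.
Qed.

Lemma gram_unit (R : realType) (m n : nat) (M : 'M[R]_(m, n)) :
  \rank M = n -> M^T *m M \in unitmx.
Proof.
move=> rM; rewrite -row_free_unit -kermx_eq0; apply/eqP/row_matrixP => i.
rewrite row0; set u := row i _.
have uG : u *m (M^T *m M) = 0.
  by apply/sub_kermxP; apply: row_sub.
have uM : u *m M^T = 0.
  apply/rowP => j; rewrite [RHS]mxE; apply/eqP.
  have : (u *m M^T *m (u *m M^T)^T) 0 0 = 0.
    by rewrite trmx_mul trmxK mulmxA -(mulmxA u) uG mul0mx mxE.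
  rewrite mxE => /eqP; rewrite psumr_eq0 => [/allP/(_ j)|k _]; last first.
    by rewrite [X in _ * X]mxE -expr2 sqr_ge0.
  rewrite mem_index_enum => /(_ isT) /=.
  by rewrite [X in _ * X]mxE mulf_eq0 orbb.
apply/(@row_free_inj _ _ _ _ M^T); last by rewrite uM mul0mx.
by rewrite /row_free mxrank_tr rM.
Qed.

Lemma mppinvP (R : realType) (m n : nat) (M : 'M[R]_(m, n)) :
  penrose M (mppinv M).
Proof.
rewrite /mppinv; case: xgetP => //= noX; exfalso.
have [r [B [D [BD uB uD]]]] : exists r (B : 'M[R]_(m, r)) (D : 'M[R]_(r, n)),
    [/\ M = B *m D, B^T *m B \in unitmx & D *m D^T \in unitmx].
  exists (\rank M), (col_base M), (row_base M); split.
  - by rewrite mulmx_base.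
  - by apply: gram_unit; apply/eqP; exact: col_base_full.
  - rewrite -{1}[row_base M]trmxK; apply: gram_unit.
    by rewrite mxrank_tr; apply/eqP; exact: row_base_free.
pose BI := invmx (B^T *m B) *m B^T; pose DI := D^T *m invmx (D *m D^T).
have BIB : BI *m B = 1%:M by rewrite /BI -mulmxA mulVmx.
have DDI : D *m DI = 1%:M by rewrite /DI mulmxA mulmxV.
have MX : M *m (DI *m BI) = B *m BI.
  by rewrite BD -mulmxA (mulmxA D) DDI mul1mx.
have XM : DI *m BI *m M = DI *m D.
  by rewrite BD -mulmxA (mulmxA BI) BIB mul1mx.
apply: (noX (DI *m BI)); split; rewrite ?MX ?XM.
- by rewrite BD -mulmxA (mulmxA BI) BIB mul1mx.
- by rewrite -mulmxA (mulmxA D) DDI mul1mx.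
- by rewrite /BI !trmx_mul trmxK trmx_inv trmx_mul trmxK mulmxA.
- by rewrite /DI !trmx_mul trmxK trmx_inv trmx_mul trmxK mulmxA.
Qed.

Definition cond2 (R : realType) (m n : nat) (M : 'M[R]_(m, n)) : R :=
  mxnorm2 M * mxnorm2 (mppinv M).

Definition compact_QR (R : realType) (d n : nat)
    (C Q : 'M[R]_(d, n)) (T : 'M[R]_n) : Prop :=
  [/\ C = Q *m T, Q^T *m Q = 1%:M,
      (forall i j : 'I_n, (j < i)%N -> T i j = 0) & T \in unitmx].

Definition pad0 (R : realType) (m p : nat) (x : 'cV[R]_m) : 'cV[R]_(m + p) :=
  col_mx x 0.

(* The sequences are indexed as in the mathematics: u_i, z_i, hat u_i are
   meaningful for 1 <= i <= k, v_i for 1 <= i <= k + 1, and beta_i, hat beta_i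
   for 0 <= i <= k.  The value of u and uh at 0 is irrelevant since
   beta_0 = hat beta_0 = 0. *)
Record jbd_run (R : realType) (m p n : nat) : Type := JBDRun {
  jbd_s : 'cV[R]_n;
  jbd_u : nat -> 'cV[R]_m;
  jbd_v : nat -> 'cV[R]_(m + p);
  jbd_z : nat -> 'cV[R]_n;
  jbd_uh : nat -> 'cV[R]_p;
  jbd_alpha : nat -> R;
  jbd_beta : nat -> R;
  jbd_alphah : nat -> R;
  jbd_betah : nat -> R
}.

Definition jbd_residual (R : realType) (m p n : nat) (C : 'M[R]_(m + p, n))
    (J : jbd_run R m p n) (i : nat) : 'cV[R]_(m + p) :=
  pad0 p (jbd_u J i) - C *m jbd_z J i.

Record jbd_step (R : realType) (m p n : nat) (C : 'M[R]_(m + p, n)) (tau : R)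
    (J : jbd_run R m p n) (i : nat) : Prop := JBDStep {
  jbd_alpha_gt0 : 0 < jbd_alpha J i;
  jbd_beta_gt0 : 0 < jbd_beta J i;
  jbd_alphah_gt0 : 0 < jbd_alphah J i;
  jbd_u_eq : jbd_alpha J i *: jbd_u J i =
    usubmx (jbd_v J i) - jbd_beta J i.-1 *: jbd_u J i.-1;
  jbd_u_norm : norm2 (jbd_u J i) = 1;
  (* x / 0 = 0 here, so an exact inner solution (zero residual) is accepted *)
  jbd_inner : norm2 (C^T *m jbd_residual C J i) /
    (mxnorm2 C * norm2 (jbd_residual C J i)) <= tau;
  jbd_v_eq : jbd_beta J i *: jbd_v J i.+1 =
    C *m jbd_z J i - jbd_alpha J i *: jbd_v J i;
  jbd_v_norm : norm2 (jbd_v J i.+1) = 1;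
  jbd_uh_eq : jbd_alphah J i *: jbd_uh J i =
    (-1) ^+ i.-1 *: dsubmx (jbd_v J i) - jbd_betah J i.-1 *: jbd_uh J i.-1;
  jbd_uh_norm : norm2 (jbd_uh J i) = 1;
  jbd_betah_eq : jbd_betah J i = jbd_alpha J i * jbd_beta J i / jbd_alphah J i
}.

Record inexact_jbd (R : realType) (m p n : nat) (A : 'M[R]_(m, n))
    (L : 'M[R]_(p, n)) (tau : R) (k : nat) (J : jbd_run R m p n) : Prop :=
  InexactJBD {
  jbd_s_neq0 : jbd_s J != 0;
  jbd_v1 : jbd_v J 1 =
    (norm2 (col_mx A L *m jbd_s J))^-1 *: (col_mx A L *m jbd_s J);
  jbd_beta0 : jbd_beta J 0 = 0;
  jbd_betah0 : jbd_betah J 0 = 0;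
  jbd_steps : forall i, (1 <= i <= k)%N -> jbd_step (col_mx A L) tau J i
}.

(* Main.v *)
Require Import Defs.
From HB Require Import structures.
From mathcomp Require Import all_boot all_order all_algebra.
From mathcomp Require Import all_classical all_reals all_analysis.
From mathcomp Require Import ring lra.
Import Order.TTheory GRing.Theory Num.Theory.
Import numFieldNormedType.Exports.
Local Open Scope classical_set_scope.
Local Open Scope ring_scope.

(** Since [C z_i] lies in the range of [Q], the projector [Q Q^T] fixes it, so
    the perturbation is forced: [g_i = Q Q^T r_i], the orthogonal projection of the
    inner residual [r_i] onto the range of [C].

    The stopping criterion controls [C^T r_i], and the projector can be read as
    [Q Q^T = C C^+ = (C^+)^T C^T] ([trmx_pinv_mul_trmx]).  As a matrix and its
    transpose have the same spectral norm ([norm2_trmx_mulmx_le]), this gives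
    [|g_i| <= eps |r_i|] with [eps = cond2 C * tau] ([norm2_projected_residual]).

    Conversely [r_i] splits as [(u_i, 0) - Q Q^T (u_i, 0)], of norm at most
    [|u_i| = 1], plus [g_i]; hence [|r_i| <= 1 + |g_i|].  Together,
    [|g_i| <= eps / (1 - eps) = eps + eps^2 / (1 - eps)] when [eps < 1], which
    is the announced bound with remainder [t^2 / (1 - t)], even with the
    leading constant 1 in place of 3. *)

(** * The Euclidean inner product and norm *)

Definition dotv {R : realType} {d : nat} (x y : 'cV[R]_d) : R :=
  \sum_(i < d) x i 0 * y i 0.

Section EuclideanNorm.
Context {R : realType} {d : nat}.
Implicit Types x y z : 'cV[R]_d.

Lemma dotvE x y : dotv x y = (x^T *m y) 0 0.
Proof. by rewrite mxE; apply: eq_bigr => i _; rewrite mxE. Qed.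

Lemma dotvC x y : dotv x y = dotv y x.
Proof. by apply: eq_bigr => i _; rewrite mulrC. Qed.

Lemma dotvDr x y z : dotv x (y + z) = dotv x y + dotv x z.
Proof. by rewrite !dotvE mulmxDr mxE. Qed.

Lemma dotvZr a x y : dotv x (a *: y) = a * dotv x y.
Proof. by rewrite !dotvE -scalemxAr mxE. Qed.

Lemma dotvDl x y z : dotv (x + y) z = dotv x z + dotv y z.
Proof. by rewrite dotvC dotvDr !(dotvC z). Qed.

Lemma dotvZl a x y : dotv (a *: x) y = a * dotv x y.
Proof. by rewrite dotvC dotvZr dotvC. Qed.

Lemma dotvv_ge0 x : 0 <= dotv x x.
Proof. by apply: sumr_ge0 => i _; rewrite -expr2 sqr_ge0. Qed.

Lemma norm2_ge0 x : 0 <= norm2 x.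
Proof. exact: sqrtr_ge0. Qed.

Lemma sqr_norm2 x : norm2 x ^+ 2 = dotv x x.
Proof.
rewrite /norm2 sqr_sqrtr; first by apply: eq_bigr => i _; rewrite expr2.
by apply: sumr_ge0 => i _; rewrite sqr_ge0.
Qed.

Lemma norm2_0 : norm2 (0 : 'cV[R]_d) = 0.
Proof. by apply/eqP; rewrite -sqrf_eq0 sqr_norm2 dotvE mulmx0 mxE. Qed.

Lemma norm2_eq0 x : norm2 x = 0 -> x = 0.
Proof.
move=> x0; have /eqP : dotv x x = 0 by rewrite -sqr_norm2 x0 expr0n.
rewrite psumr_eq0 => [/allP x0i|i _]; last by rewrite -expr2 sqr_ge0.
apply/colP => i; rewrite mxE; apply/eqP.
by have := x0i i; rewrite mem_index_enum mulf_eq0 orbb; exact.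
Qed.

Lemma norm2Z a x : 0 <= a -> norm2 (a *: x) = a * norm2 x.
Proof.
move=> a0; apply/eqP; rewrite -(@eqrXn2 _ 2) ?mulr_ge0 ?norm2_ge0 //.
by rewrite exprMn !sqr_norm2 dotvZl dotvZr mulrA expr2.
Qed.

(** The square of the norm of [c x - b y], with [b] and [c] the inner products
    of [y] with [x] and with itself, is [c (a c - b^2)], where [a] is the
    inner product of [x] with itself. *)
Lemma cauchy_schwarz_sqr x y : dotv x y ^+ 2 <= dotv x x * dotv y y.
Proof.
have := dotvv_ge0 (dotv y y *: x + (- dotv x y) *: y).
rewrite !(dotvDl, dotvDr, dotvZl, dotvZr) (dotvC y x) => h.
have [y0|yN0] := eqVneq (dotv y y) 0.
  have /norm2_eq0 -> : norm2 y = 0 by apply/eqP; rewrite -sqrf_eq0 sqr_norm2 y0.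
  by rewrite !dotvE !mulmx0 !mxE expr0n mulr0.
have ygt0 : 0 < dotv y y by rewrite lt0r yN0 dotvv_ge0.
rewrite -subr_ge0 -(pmulr_rge0 _ ygt0); apply: le_trans h _.
by rewrite le_eqVlt; apply/orP; left; apply/eqP; ring.
Qed.

Lemma cauchy_schwarz x y : dotv x y <= norm2 x * norm2 y.
Proof.
rewrite (le_trans (ler_norm _))// -(@ler_pXn2r _ 2) ?nnegrE ?mulr_ge0 ?norm2_ge0 //.
by rewrite real_normK ?num_real // exprMn !sqr_norm2 cauchy_schwarz_sqr.
Qed.

Lemma norm2_triangle x y : norm2 (x + y) <= norm2 x + norm2 y.
Proof.
rewrite -(@ler_pXn2r _ 2) ?nnegrE ?addr_ge0 ?norm2_ge0 //.
rewrite sqr_norm2 !(dotvDl, dotvDr) (dotvC y x) sqrrD !sqr_norm2.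
have := cauchy_schwarz x y; lra.
Qed.

End EuclideanNorm.

Lemma dotv_mulmx {R : realType} {m n : nat} (M : 'M[R]_(m, n)) x y :
  dotv x (M *m y) = dotv (M^T *m x) y.
Proof. by rewrite !dotvE trmx_mul trmxK mulmxA. Qed.

Lemma norm2_pad0 {R : realType} {m : nat} (p : nat) (x : 'cV[R]_m) :
  norm2 (pad0 p x) = norm2 x.
Proof.
rewrite /norm2 big_split_ord /= [X in _ + X]big1 => [|i _].
  by rewrite addr0; congr Num.sqrt; apply: eq_bigr => i _; rewrite col_mxEu.
by rewrite col_mxEd mxE expr0n.
Qed.

(** * The spectral norm *)

Section SpectralNorm.
Context {R : realType} {m n : nat}.
Implicit Types (M : 'M[R]_(m, n)) (x : 'cV[R]_n) (y : 'cV[R]_m).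

(** The supremum defining [mxnorm2] is over a set bounded by the Frobenius norm:
    apply Cauchy-Schwarz to each row. *)
Lemma mxnorm2_has_sup M :
  has_sup [set norm2 (M *m x) | x in [set x : 'cV[R]_n | norm2 x <= 1]].
Proof.
split; first by exists (norm2 (M *m 0)), 0 => //=; rewrite norm2_0 ler01.
exists (Num.sqrt (\sum_(i < m) dotv (row i M)^T (row i M)^T)) => _ /= [x x1 <-].
rewrite ler_wsqrtr //; apply: ler_sum => i _.
have -> : (M *m x) i 0 = dotv (row i M)^T x.
  by rewrite mxE; apply: eq_bigr => j _; rewrite !mxE.
apply: le_trans (cauchy_schwarz_sqr _ _) _.
by rewrite ler_piMr ?dotvv_ge0 // -sqr_norm2 expr_le1 ?norm2_ge0.
Qed.

Lemma mxnorm2_ge0 M : 0 <= mxnorm2 M.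
Proof.
apply: (sup_upper_bound (mxnorm2_has_sup M)).
by exists 0 => /=; rewrite ?mulmx0 norm2_0 ?ler01.
Qed.

Lemma norm2_mulmx_le M x : norm2 (M *m x) <= mxnorm2 M * norm2 x.
Proof.
have [/norm2_eq0 ->|xN0] := eqVneq (norm2 x) 0.
  by rewrite mulmx0 !norm2_0 mulr0.
have x0 : 0 < norm2 x by rewrite lt0r xN0 norm2_ge0.
rewrite -ler_pdivrMr // mulrC -norm2Z ?invr_ge0 ?norm2_ge0 // scalemxAr.
apply: (sup_upper_bound (mxnorm2_has_sup M)).
by exists ((norm2 x)^-1 *: x) => //=; rewrite norm2Z ?invr_ge0 ?norm2_ge0 // mulVf.
Qed.

(** By Cauchy-Schwarz, the square of the norm of [M^T y], which is the inner
    product of [y] and [M (M^T y)], is at most [|y| |M| |M^T y|]. *)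
Lemma norm2_trmx_mulmx_le M y : norm2 (M^T *m y) <= mxnorm2 M * norm2 y.
Proof.
have [->|N0] := eqVneq (norm2 (M^T *m y)) 0.
  by rewrite mulr_ge0 ?mxnorm2_ge0 ?norm2_ge0.
have gt0 : 0 < norm2 (M^T *m y) by rewrite lt0r N0 norm2_ge0.
rewrite -(ler_pM2r gt0) -expr2 sqr_norm2 -dotv_mulmx.
apply: le_trans (cauchy_schwarz _ _) _; rewrite [leRHS]mulrAC [leLHS]mulrC.
by rewrite ler_wpM2r ?norm2_ge0 // norm2_mulmx_le.
Qed.

(** Clearing denominators is legitimate also where the quotient takes its
    default value 0: if [M] or [r] vanishes, so does [M^T r]. *)
Lemma norm2_trmx_mulmx_quotient M y (tau : R) :
  norm2 (M^T *m y) / (mxnorm2 M * norm2 y) <= tau ->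
  norm2 (M^T *m y) <= tau * (mxnorm2 M * norm2 y).
Proof.
have := norm2_trmx_mulmx_le M y.
have [-> le0 _|N0 _] := eqVneq (mxnorm2 M * norm2 y) 0; first by rewrite mulr0.
by rewrite ler_pdivrMr // lt0r N0 mulr_ge0 ?mxnorm2_ge0 ?norm2_ge0.
Qed.

End SpectralNorm.

(** * Orthogonal projection onto the range of C *)

Section Projection.
Context {R : realType} {d n : nat}.
Context {C Q : 'M[R]_(d, n)} {T : 'M[R]_n} (CQT : compact_QR C Q T).

Lemma mppinv_compact_QR : mppinv C = invmx T *m Q^T.
Proof.
have [-> QQ _ Tu] := CQT; apply: penrose_uniq (mppinvP _) _.
have CX : Q *m T *m (invmx T *m Q^T) = Q *m Q^T.
  by rewrite mulmxA mulmxK.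
have XC : invmx T *m Q^T *m (Q *m T) = 1%:M.
  by rewrite -mulmxA (mulmxA Q^T) QQ mul1mx mulVmx.
split; rewrite ?CX ?XC.
- by rewrite mulmxA -(mulmxA Q) QQ mulmx1.
- by rewrite mul1mx.
- by rewrite trmx_mul trmxK.
- by rewrite trmx1.
Qed.

Lemma trmx_pinv_mul_trmx : (mppinv C)^T *m C^T = Q *m Q^T.
Proof.
have [CE _ _ Tu] := CQT.
by rewrite -trmx_mul mppinv_compact_QR CE mulmxA mulmxK // trmx_mul trmxK.
Qed.

Lemma compact_QR_projK : Q *m Q^T *m C = C.
Proof. by have [-> QQ _ _] := CQT; rewrite mulmxA -(mulmxA Q) QQ mulmx1. Qed.

Lemma norm2_projected_residual (r : 'cV[R]_d) (tau : R) :
  norm2 (C^T *m r) / (mxnorm2 C * norm2 r) <= tau ->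
  norm2 (Q *m Q^T *m r) <= cond2 C * tau * norm2 r.
Proof.
move=> /norm2_trmx_mulmx_quotient Cr; rewrite -trmx_pinv_mul_trmx -mulmxA.
apply: le_trans (norm2_trmx_mulmx_le _ _) _.
apply: le_trans (ler_wpM2l (mxnorm2_ge0 _) Cr) _.
by rewrite le_eqVlt; apply/orP; left; apply/eqP; rewrite /cond2; ring.
Qed.

(** Pythagoras: the squared norm of the orthogonal component is the squared
    norm of [x] minus that of [Q^T x]. *)
Lemma norm2_complement_le (x : 'cV[R]_d) : norm2 (x - Q *m Q^T *m x) <= norm2 x.
Proof.
have [_ QQ _ _] := CQT.
rewrite -(@ler_pXn2r _ 2) ?nnegrE ?norm2_ge0 // !sqr_norm2 -scaleN1r.
rewrite !(dotvDl, dotvDr, dotvZl, dotvZr) (dotvC (Q *m Q^T *m x) x).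
have -> : dotv (Q *m Q^T *m x) (Q *m Q^T *m x) = dotv x (Q *m Q^T *m x).
  by rewrite -{2}mulmxA dotv_mulmx mulmxA mulmxA QQ mul1mx -mulmxA [in RHS]dotv_mulmx.
have : 0 <= dotv x (Q *m Q^T *m x) by rewrite -mulmxA dotv_mulmx dotvv_ge0.
lra.
Qed.

Lemma projected_residual_bound (u : 'cV[R]_d) (z : 'cV[R]_n) (tau : R) :
    let r := u - C *m z in
    norm2 u = 1 -> 0 <= tau -> cond2 C * tau < 1 ->
    norm2 (C^T *m r) / (mxnorm2 C * norm2 r) <= tau ->
  norm2 (Q *m Q^T *m r) <= cond2 C * tau / (1 - cond2 C * tau).
Proof.
move=> r u1 tau0 eps1 /norm2_projected_residual; set eps := cond2 C * tau => gr.
have eps0 : 0 <= eps by rewrite !mulr_ge0 ?mxnorm2_ge0.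
have rE : r = (u - Q *m Q^T *m u) + Q *m Q^T *m r.
  by rewrite mulmxBr mulmxA compact_QR_projK addrA subrK.
have r1 : norm2 r <= 1 + norm2 (Q *m Q^T *m r).
  rewrite {1}rE; apply: le_trans (norm2_triangle _ _) _.
  by rewrite lerD2r -u1 norm2_complement_le.
rewrite ler_pdivlMr ?subr_gt0 //.
have := le_trans gr (ler_wpM2l eps0 r1); lra.
Qed.

End Projection.

(** * The remainder term and the theorem *)

Lemma sqr_div_1subr_bigO (R : realType) :
  (fun t : R => t ^+ 2 / (1 - t)) =O_ (0^'+) (fun t : R => t ^+ 2).
Proof.
apply/eqO_exP; exists 2 => //; near=> t.
have t2 : t < 2^-1 by near: t; apply: nbhs_right_lt; rewrite invr_gt0.
have d0 : 0 < 1 - t by lra.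
rewrite normrM normfV (gtr0_norm d0) mulrC ler_wpM2r //.
rewrite -[leRHS]invrK lef_pV2 ?posrE ?invr_gt0 //; lra.
Unshelve. all: by end_near. Qed.

Theorem theorem3p1 (R : realType) :
  exists phi : R -> R,
    (phi =O_ (0^'+) (fun t : R => t ^+ 2)) /\
    forall (m n p : nat) (A : 'M[R]_(m, n)) (L : 'M[R]_(p, n))
      (Q : 'M[R]_(m + p, n)) (T : 'M[R]_n)
      (tau : R) (k : nat) (J : jbd_run R m p n),
    \rank (col_mx A L) = n ->
    compact_QR (col_mx A L) Q T ->
    0 < tau ->
    inexact_jbd A L tau k J ->
    exists g : nat -> 'cV[R]_(m + p),
      (forall i, (1 <= i <= k)%N ->
         range (mulmx Q : 'cV[R]_n -> 'cV[R]_(m + p)) (g i) /\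
         jbd_beta J i *: jbd_v J i.+1 =
           Q *m Q^T *m pad0 p (jbd_u J i) - jbd_alpha J i *: jbd_v J i - g i) /\
      (cond2 (col_mx A L) * tau < 1 ->
       forall i, (1 <= i <= k)%N ->
         norm2 (g i) <= 3 * (cond2 (col_mx A L) * tau)
                        + phi (cond2 (col_mx A L) * tau)).
Proof.
exists (fun t => t ^+ 2 / (1 - t)); split; first exact: sqr_div_1subr_bigO.
move=> m n p A L Q T tau k J _ CQT tau0 [_ _ _ _ steps].
exists (fun i => Q *m Q^T *m jbd_residual (col_mx A L) J i).
split=> [i ik|eps1 i ik]; have st := steps i ik.
  split; first by exists (Q^T *m jbd_residual (col_mx A L) J i); rewrite ?mulmxA.
  rewrite (jbd_v_eq st) mulmxBr mulmxA (compact_QR_projK CQT).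
  by rewrite opprB [RHS]addrC addrA subrK.
have u1 : norm2 (pad0 p (jbd_u J i)) = 1 by rewrite norm2_pad0 (jbd_u_norm st).
apply: le_trans (projected_residual_bound CQT _ _ _ u1 (ltW tau0) eps1 (jbd_inner st)) _.
set eps := cond2 _ * tau in eps1 *.
have eps0 : 0 <= eps by rewrite !mulr_ge0 ?mxnorm2_ge0 ?ltW.
have -> : eps / (1 - eps) = eps + eps ^+ 2 / (1 - eps).
  by field; rewrite gt_eqF // subr_gt0.
by rewrite lerD2r ler_peMl // ler1n.
Qed.
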